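(* Let $d\ge 1$ be an integer, let $r,\nu,\Delta t>0$, and let $G(y;\Delta t)$ be the density of the $d$-dimensional isotropic Gaussian with zero mean and covariance $2\nu\Delta t\,I_d$. Consider the symmetric quadrature rule on $\mathbb{R}^d$ with nodes $$\{0\}\cup\{\pm r e_i\}_{i=1}^d\cup\{\pm r(e_i\pm e_j)\}_{1\le i<j\le d}$$ and associated weights $\omega_0$ for the central node $0$, $\omega_A$ for each axial node $\pm r e_i$, and $\omega_D$ for each face-diagonal node $\pm r(e_i\pm e_j)$. If the parameters are chosen as $$r=\sqrt{6\nu\Delta t},\qquad \omega_0=\frac{d^2-7d+18}{18},\qquad \omega_A=\frac{4-d}{18},\qquad \omega_D=\frac{1}{36},$$ then the quadrature rule satisfies the moment-matching conditions $$\sum_{\ell\in\mathcal{L}}\omega_\ell\,\xi_\ell^{\alpha}=\int_{\mathbb{R}^d}y^{\alpha}\,G(y;\Delta t)\,dy\qquad\text{for all multi-indices }\alpha\in\mathbb{N}_0^d\text{ with }|\alpha|\in\{0,1,\dots,5\},$$ where $(\xi_\ell)_{\ell\in\mathcal{L}}$ enumerates all the nodes above and $\omega_\ell$ is the weight associated with $\xi_\ell$.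
   Context: $e_1,\dots,e_d$ is the canonical basis of $\mathbb{R}^d$. For a multi-index $\alpha=(\alpha_1,\dots,\alpha_d)$, $|\alpha|=\alpha_1+\dots+\alpha_d$ and $y^\alpha=y_1^{\alpha_1}\cdots y_d^{\alpha_d}$. For each pair $i<j$ there are four face-diagonal nodes $\pm r(e_i\pm e_j)$ (all sign combinations), so there are $1+2d+2d(d-1)=2d^2+1$ nodes in total. Weights are allowed to be negative. *)

(* Defs.v *)
From HB Require Import structures.
From mathcomp Require Import all_boot all_order all_algebra.
From mathcomp Require Import zify.
From mathcomp Require Import all_classical all_reals all_analysis.
Set Implicit Arguments.
Unset Strict Implicit.
Unset Printing Implicit Defensive.
Import Order.TTheory GRing.Theory Num.Theory.
Import numFieldNormedType.Exports.
Local Open Scope classical_set_scope.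
Local Open Scope ring_scope.

(* The library provides the product sigma-algebra on n.-tuple R but no Lebesgue
   measure there.  It is built by recursion on n: Dirac mass on the one-point
   space 0.-tuple R, then the image of lebesgue_measure \x lebesgue_n under the
   measurable bijection R * n.-tuple R -> n.+1.-tuple R.  The recursion carries
   sigma-finiteness, which the binary product \x needs to be a measure. *)

Definition cons_pair (R : realType) (n : nat)
    (p : measurableTypeR R * n.-tuple (measurableTypeR R)) :
    n.+1.-tuple (measurableTypeR R) :=
  [the n.+1.-tuple _ of p.1 :: p.2].

Definition uncons_pair (R : realType) (n : nat)
    (t : n.+1.-tuple (measurableTypeR R)) :
    measurableTypeR R * n.-tuple (measurableTypeR R) :=
  (thead t, [tuple of behead t]).

Lemma cons_pairK (R : realType) (n : nat) :
  cancel (@cons_pair R n) (@uncons_pair R n).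
Proof.
move=> [x t]; rewrite /uncons_pair /cons_pair /= theadE; congr pair.
exact: val_inj.
Qed.

Lemma uncons_pairK (R : realType) (n : nat) :
  cancel (@uncons_pair R n) (@cons_pair R n).
Proof. by move=> t; rewrite [RHS]tuple_eta; apply: val_inj. Qed.

Lemma measurable_cons_pair (R : realType) (n : nat) :
  measurable_fun setT (@cons_pair R n).
Proof. exact: measurable_cons. Qed.

Lemma measurable_uncons_pair (R : realType) (n : nat) :
  measurable_fun setT (@uncons_pair R n).
Proof.
apply/measurable_fun_pair => /=; last exact: measurable_behead.
exact: measurable_tnth.
Qed.

HB.instance Definition _ (R : realType) (n : nat) :=
  isMeasurableFun.Build _ _ _ _ (@cons_pair R n) (@measurable_cons_pair R n).

Section lebesgue_cons.
Local Open Scope ereal_scope.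
Context (R : realType) (n : nat)
  (mu : {sigma_finite_measure set (n.-tuple (measurableTypeR R)) -> \bar R}).

Definition lebesgue_cons : set (n.+1.-tuple (measurableTypeR R)) -> \bar R :=
  pushforward (@lebesgue_measure R \x mu) (@cons_pair R n).

Let lebesgue_cons0 : lebesgue_cons set0 = 0.
Proof. exact: measure0. Qed.

Let lebesgue_cons_ge0 A : 0 <= lebesgue_cons A.
Proof. exact: measure_ge0. Qed.

Let lebesgue_cons_sigma_additive : semi_sigma_additive lebesgue_cons.
Proof. exact: measure_semi_sigma_additive. Qed.

HB.instance Definition _ := isMeasure.Build _ _ _ lebesgue_cons
  lebesgue_cons0 lebesgue_cons_ge0 lebesgue_cons_sigma_additive.

Let lebesgue_cons_sigma_finite : sigma_finite setT lebesgue_cons.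
Proof.
have /sigma_finiteP[F [TF ndF Foo]] := sigma_finiteT (@lebesgue_measure R).
have /sigma_finiteP[G [TG ndG Goo]] := sigma_finiteT mu.
exists (fun k => @uncons_pair R n @^-1` (F k `*` G k)).
  apply/seteqP; split=> // t _.
  have [k _ Fk] : (\bigcup_k F k) (uncons_pair t).1 by rewrite -TF.
  have [l _ Gl] : (\bigcup_k G k) (uncons_pair t).2 by rewrite -TG.
  exists (maxn k l) => //; split.
  - by move: Fk; exact/subsetPset/ndF/leq_maxl.
  - by move: Gl; exact/subsetPset/ndG/leq_maxr.
move=> k; have [mF Fkoo] := Foo k; have [mG Gkoo] := Goo k; split.
  rewrite -[X in measurable X]setTI.
  by apply: measurable_uncons_pair => //; exact: measurableX.
rewrite /lebesgue_cons /pushforward -comp_preimage.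
rewrite (_ : _ \o _ = id) ?preimage_id; last first.
  by apply/funext => p; exact: cons_pairK.
by rewrite product_measure1E// lte_mul_pinfty// ge0_fin_numE.
Qed.

HB.instance Definition _ := Measure_isSigmaFinite.Build _ _ _ lebesgue_cons
  lebesgue_cons_sigma_finite.

End lebesgue_cons.

Fixpoint lebesgue_tuple (R : realType) (n : nat) :
    {sigma_finite_measure set (n.-tuple (measurableTypeR R)) -> \bar R} :=
  match n with
  | 0 => \d_([tuple] : 0.-tuple (measurableTypeR R))
  | n'.+1 => lebesgue_cons (lebesgue_tuple R n')
  end.

Lemma lebesgue_tuple_box (R : realType) (n : nat)
    (A : 'I_n -> set (measurableTypeR R)) :
  (forall i, measurable (A i)) ->
  lebesgue_tuple R n [set t | forall i, A i (tnth t i)] =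
  (\prod_(i < n) lebesgue_measure (A i))%E.
Proof.
elim: n A => [|n IH] A mA.
  rewrite big_ord0 /= diracE mem_set//.
  by case.
rewrite big_ord_recl -IH//= /lebesgue_cons /pushforward -product_measure1E//=.
  congr product_measure1; apply/seteqP; split => [[x t] /= At|[x t] /= [Ax At] i].
    split; first exact: (At ord0).
    by move=> i; have := At (lift ord0 i); rewrite tnthS.
  have [j ->|->] := unliftP ord0 i; last by rewrite tnth0.
  by rewrite tnthS.
rewrite (_ : [set _ | _] = \bigcap_(i in [set: 'I_n])
    ((@tnth n _)^~ i @^-1` A (lift ord0 i))); last first.
  by apply/seteqP; split => [t /= At i _|t /= At i]; exact: At.
apply: fin_bigcap_measurable => // i _.
by rewrite -[X in measurable X]setTI; exact: measurable_tnth.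
Qed.

Definition row_of_tuple (R : realType) (d : nat) (t : d.-tuple R) : 'rV[R]_d :=
  \row_i tnth t i.

(* Valued in \bar R and not truncated by fine: for a measurable f, equality with
   a real number includes integrability, since +oo - +oo = -oo in \bar R. *)
Definition integral_Rd (R : realType) (d : nat) (f : 'rV[R]_d -> R) : \bar R :=
  (\int[lebesgue_tuple R d]_t (f (row_of_tuple t))%:E)%E.

Definition monomial (R : realType) (d : nat) (alpha : 'I_d -> nat)
    (y : 'rV[R]_d) : R :=
  \prod_(i < d) y 0 i ^+ alpha i.

Definition gaussian_density (R : realType) (d : nat) (m : 'rV[R]_d)
    (S : 'M[R]_d) (y : 'rV[R]_d) : R :=
  (Num.sqrt ((2 * pi) ^+ d * \det S))^-1 *
  expR (- ((y - m) *m invmx S *m (y - m)^T) 0 0 / 2).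

Definition gauss_kernel (R : realType) (d : nat) (nu dt : R) : 'rV[R]_d -> R :=
  gaussian_density 0 (2 * nu * dt)%:M.

(* None is the central node, inl (i, s) the axial node (-1)^s r e_i, and
   inr ((i, j), (s, t)) the face-diagonal node (-1)^s r (e_i + (-1)^t e_j). *)
Definition node_index (d : nat) : finType :=
  option (('I_d * bool) +
          ({p : 'I_d * 'I_d | (p.1 < p.2)%N} * (bool * bool)))%type.

Definition node (R : realType) (d : nat) (r : R) (l : node_index d) :
    'rV[R]_d :=
  let e i : 'rV[R]_d := delta_mx 0 i in
  match l with
  | None => 0
  | Some (inl (i, s)) => (-1) ^+ s *: (r *: e i)
  | Some (inr (p, (s, t))) =>
      (-1) ^+ s *: (r *: (e (val p).1 + (-1) ^+ t *: e (val p).2))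
  end.

Definition weight (R : realType) (d : nat) (w0 wA wD : R)
    (l : node_index d) : R :=
  match l with
  | None => w0
  | Some (inl _) => wA
  | Some (inr _) => wD
  end.

Lemma card_node_index (d : nat) : #|node_index d| = (2 * d ^ 2 + 1)%N.
Proof.
rewrite card_option card_sum !card_prod card_ord card_bool card_sig.
have -> : #|[pred p : 'I_d * 'I_d | (p.1 < p.2)%N]| = 'C(d, 2).
  rewrite -sum1_card (eq_bigl (fun p : 'I_d * 'I_d => xpredT p.1 && (p.1 < p.2)%N))//.
  rewrite -(pair_big_dep xpredT (fun i j : 'I_d => (i < j)%N) (fun _ _ => 1%N))/=.
  rewrite (exchange_big_dep xpredT)//= -bin2_sum big_mkord; apply: eq_bigr => j _.
  rewrite sum1_card -[RHS]card_ord.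
  have inj : injective (widen_ord (ltnW (ltn_ord j))).
    by move=> x y /(congr1 val) /= /val_inj.
  rewrite -(card_codom inj).
  apply: eq_card => i; apply/idP/codomP => [ij|[k ->]]; last exact: (ltn_ord k).
  by exists (Ordinal ij); exact: val_inj.
have := mul_bin_diag d 1; rewrite bin1.
case: d => [|d] //=; lia.
Qed.

(* Main.v *)
Require Import Defs.
From mathcomp Require Import all_boot all_order all_algebra.
From mathcomp Require Import zify ring.
From mathcomp Require Import all_classical all_reals all_analysis.
From mathcomp Require Import measurable_realfun.
Set Implicit Arguments.
Unset Strict Implicit.
Unset Printing Implicit Defensive.
Import Order.TTheory GRing.Theory Num.Theory.
Import numFieldNormedType.Exports.
Local Open Scope classical_set_scope.
Local Open Scope ring_scope.

(* The Gaussian is a product of one-dimensional densities of variance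
   s^2 = 2 nu dt = r^2 / 3, so by Fubini its moments are products of the
   one-dimensional ones, which obey m(k+2) = (k+1) s^2 m(k) because the
   derivative of x^(k+1) times the density integrates to 0.  On the quadrature
   side both members vanish when some exponent is odd; since |alpha| <= 5, the
   remaining multi-indices are 0, 2 e_k, 4 e_k and 2 e_k + 2 e_l. *)

(** * Integral of a derivative over the real line *)

(** By the fundamental theorem the integral over [-(n+1), n+1] is a difference of boundary values,
    which tends to 0; dominated convergence with bound |f| identifies the limit with the whole
    integral. *)
Lemma integral_derive_eq0 (R : realType) (f F : R -> R) :
  continuous f ->
  (forall x, is_derive (x : R^o) (1 : R) (F : R^o -> R^o) (f x)) ->
  (@lebesgue_measure R).-integrable setT (EFin \o f) ->
  F n%:R @[n --> \oo] --> (0 : R) -> F (- n%:R) @[n --> \oo] --> (0 : R) ->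
  (\int[@lebesgue_measure R]_x (f x)%:E = 0)%E.
Proof.
move=> cf dF intf Fp Fm.
(* The radius [n.+1] keeps the endpoints strictly ordered even at n = 0; hence the shifts by one in
   the boundary limits below. *)
pose D n : set R := `[- n.+1%:R, n.+1%:R]%classic.
pose g n : R -> \bar R := (EFin \o f) \_ (D n).
have mf := measurable_int _ intf.
have FTC n : (\int[@lebesgue_measure R]_(x in D n) (f x)%:E =
              (F n.+1%:R - F (- n.+1%:R))%:E)%E.
  rewrite EFinB; apply: continuous_FTC2.
  - by rewrite gtrN// ltr0n.
  - exact: continuous_subspaceT.
  - have cF : continuous F.
      by move=> x; apply/differentiable_continuous/derivable1_diffP/ex_derive.
    split; first by move=> x _; exact: ex_derive.
      by apply: cvg_at_right_filter; exact: cF.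
    by apply: cvg_at_left_filter; exact: cF.
  - by move=> x _; rewrite derive1E derive_val.
have lim0 : (\int[@lebesgue_measure R]_x g n x)%E @[n --> \oo] -->
    (0 : \bar R)%E.
  under eq_fun do rewrite -integral_mkcond FTC.
  apply/fine_cvgP; split; first by near=> n.
  have -> : (0 : R) = 0 - 0 by rewrite subr0.
  apply: cvgB.
  - have /= := Fp; rewrite -(cvg_shiftS (fun n => F n%:R)); exact.
  - have /= := Fm; rewrite -(cvg_shiftS (fun n => F (- n%:R))); exact.
have mg n : measurable_fun setT (g n).
  apply/(measurable_restrictT _ (measurable_itv _)).
  exact: measurable_funTS.
have gf : {ae @lebesgue_measure R, forall x, setT x ->
    g n x @[n --> \oo] --> (EFin \o f) x}.
  apply: aeW => x _; apply: cvg_near_cst; near=> n.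
  rewrite /g patchE mem_set//= /D /= in_itv/= -ler_norml.
  near: n; exists (Num.bound `|x|) => // n /= nx.
  apply: (le_trans (ltW (archi_boundP _))) => //.
  by rewrite ler_nat (leq_trans nx).
have gb : {ae @lebesgue_measure R, forall x n, setT x ->
    (`|g n x| <= (abse \o (EFin \o f)) x)%E}.
  apply: aeW => x n _; rewrite /g patchE; case: ifP => //= _.
  by rewrite normr0 lee_fin.
have [_ _ gint] := @dominated_convergence _ _ _
  (@lebesgue_measure R) setT measurableT g _ _ mg mf gf
  (integrable_abse intf) gb.
exact: (cvg_unique _ gint lim0).
Unshelve. all: by end_near. Qed.

(** * Gaussian decay against polynomial growth *)

Lemma expR_ge_Xn_fact (R : realType) (n : nat) (x : R) :
  0 <= x -> x ^+ n <= n`!%:R * expR x.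
Proof.
case: n => [|n] x0; first by rewrite expr0 fact0 mul1r -expR0 ler_expR.
rewrite mulrC -ler_pdivrMr ?ltr0n ?fact_gt0//.
by rewrite (le_trans _ (expR_ge1Dxn n x0))// lerDr.
Qed.

(** Splitting at |x| = 1 trades an arbitrary power for a power of [x ^+ 2], the quantity in the
    Gaussian exponent. *)
Lemma normr_Xn_le (R : realDomainType) (n : nat) (x : R) :
  `|x| ^+ n <= 1 + (x ^+ 2) ^+ n.
Proof.
have [x1|/ltW x1] := leP `|x| 1.
  rewrite (le_trans (exprn_ile1 _ (normr_ge0 _) x1))//.
  by rewrite lerDl exprn_ge0 ?sqr_ge0.
rewrite -real_normK ?num_real// -exprM mulnC.
rewrite (@le_trans _ _ (`|x| ^+ (n * 2)))//; last by rewrite lerDr.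
by rewrite ler_weXn2l// leq_pmulr.
Qed.

(* [|x|^k <= 1 + x^(2k)], and powers of [x^2] are absorbed by passing from
   standard deviation [s] to [2s]. *)
Lemma normal_pdf_Xn_bound (R : realType) (s : R) (k : nat) : s != 0 ->
  exists C : R, forall x,
    `|x ^+ k * normal_pdf 0 s x| <= C * normal_pdf 0 (2 * s) x.
Proof.
move=> s0; have s20 : 0 < s ^+ 2 by rewrite exprn_even_gt0.
have p20 : 0 < normal_peak (2 * s) :> R.
  by rewrite normal_peak_gt0// mulf_neq0.
(* 1/(2 s^2) - 1/(8 s^2) = 3/(8 s^2) = 1/c, so passing from s to 2s multiplies [normal_fun] by
   exp(x^2/c). *)
pose c : R := 8 / 3 * s ^+ 2.
have c0 : 0 <= c by rewrite /c mulr_ge0// ltW.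
(* The quotient of peaks exchanges the normalizing constants; the first factor comes from 1 +
   (x^2)^k = 1 + c^k u^k <= (1 + c^k k!) e^u with u = x^2/c. *)
exists ((1 + c ^+ k * k`!%:R) * normal_peak s / normal_peak (2 * s)) => x.
rewrite !normal_pdfE ?mulf_neq0// normrM normrX.
rewrite (ger0_norm (mulr_ge0 (normal_peak_ge0 _) (normal_fun_ge0 _ _ _))).
rewrite mulrA -[leRHS]mulrA (mulrA (normal_peak (2 * s))^-1).
rewrite mulVf ?gt_eqF// mul1r [leLHS]mulrAC [leRHS]mulrAC.
rewrite ler_wpM2r ?normal_peak_ge0//.
pose u := x ^+ 2 / c.
have u0 : 0 <= u by rewrite /u divr_ge0 ?sqr_ge0.
have -> : normal_fun 0 (2 * s) x = expR u * normal_fun 0 s x :> R.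
  rewrite /normal_fun -expRD /u /c; congr expR; rewrite !subr0.
  by field.
rewrite mulrA ler_wpM2r ?normal_fun_ge0//.
rewrite (le_trans (normr_Xn_le _ _))// mulrDl mul1r lerD//.
  by rewrite -expR0 ler_expR.
rewrite (_ : x ^+ 2 = c * u); last by rewrite /u /c; field.
by rewrite exprMn -mulrA ler_wpM2l ?exprn_ge0// expR_ge_Xn_fact.
Qed.

(** * Moments of the one-dimensional normal density *)

Section normal_moments.
Context (R : realType) (s : R) (s0 : s != 0).
Local Notation mu := (@lebesgue_measure R).

(** Closed form: (k-1)!! s^k for even k, and 0 for odd k. *)
Fixpoint normal_moment (k : nat) : R :=
  match k with
  | 0 => 1
  | 1 => 0
  | j.+2 => j.+1%:R * s ^+ 2 * normal_moment j
  end.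

Lemma continuous_Xn_normal_pdf k :
  continuous (fun x : R => x ^+ k * normal_pdf 0 s x).
Proof.
move=> x; apply: cvgM; first exact: exprn_continuous.
exact: continuous_normal_pdf.
Qed.

Lemma integrable_Xn_normal_pdf k :
  mu.-integrable setT (EFin \o (fun x : R => x ^+ k * normal_pdf 0 s x)).
Proof.
have [C leC] := normal_pdf_Xn_bound k s0.
apply: (@le_integrable _ _ _ mu setT _ _
    (EFin \o (fun x : R => C * normal_pdf 0 (2 * s) x))) => //.
- apply/measurable_EFinP; apply: continuous_measurable_fun.
  exact: continuous_Xn_normal_pdf.
- by move=> x _ /=; rewrite lee_fin (le_trans (leC x))// ler_norm.
- exact: (integrableZl measurableT C (integrable_normal_pdf 0 (2 * s))).
Qed.

(** The two terms carry the exponents k-1 and k+1, so a vanishing integral links two moments. At k =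
    0 the truncated [k.-1] is harmless because its coefficient is 0. *)
Lemma is_derive_Xn_normal_pdf k (x : R) :
  is_derive (x : R^o) (1 : R)
    ((fun x : R => x ^+ k * normal_pdf 0 s x) : R^o -> R^o)
    (k%:R * (x ^+ k.-1 * normal_pdf 0 s x)
     - s ^- 2 * (x ^+ k.+1 * normal_pdf 0 s x)).
Proof.
rewrite normal_pdfE//.
have dq : is_derive (x : R^o) (1 : R)
    ((fun x : R => - (x - 0) ^+ 2 / (s ^+ 2 *+ 2)) : R^o -> R^o)
    (- x / s ^+ 2).
  rewrite (_ : (fun _ => _) = (- (s ^+ 2 *+ 2)^-1) \*: ((@id R^o) ^+ 2)).
    apply: is_derive_eq; rewrite /= expr1 /GRing.scale/= mulr1.
    by field.
  by apply/funext => y /=; rewrite subr0 mulNr mulrC -mulNr.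
have de : is_derive (x : R^o) (1 : R) (normal_fun 0 s : R^o -> R^o)
    (normal_fun 0 s x * (- x / s ^+ 2)).
  exact: (@is_derive1_comp _ expR).
rewrite (_ : (fun _ => _) =
    normal_peak s \*: (((@id R^o) ^+ k) * (normal_fun 0 s : R^o -> R^o))).
  apply: is_derive_eq; rewrite exprfctE /= /GRing.scale/= mulr1.
  case: k => [|k] /=; first by rewrite !expr0 expr1 !mul0r; field.
  by rewrite !exprS; field.
by apply/funext => y; rewrite exprfctE /= mulrCA.
Qed.

(** A sequence with |u n| = n covers both n and -n. *)
Lemma cvg_Xn_normal_pdf0 k (u : nat -> R) : (forall n, `|u n| = n%:R) ->
  u n ^+ k * normal_pdf 0 s (u n) @[n --> \oo] --> (0 : R).
Proof.
move=> un.
have [C leC] := normal_pdf_Xn_bound k s0.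
have [C' leC'] := normal_pdf_Xn_bound k.+1 s0.
(* (n+1) |u^k p(u)| = |u^k p(u)| + |u^(k+1) p(u)| for the density p, and each summand is at most a
   constant times the peak of the wider density; this gives decay like 1/(n+1). *)
pose B := (`|C| + `|C'|) * normal_peak (2 * s).
have leB n : `|u n ^+ k * normal_pdf 0 s (u n)| <= B * harmonic n.
  rewrite /harmonic /= ler_pdivlMr// -natr1 addrC mulrDr mulr1 /B mulrDl.
  rewrite -(un n) -[X in _ + X]normrM [X in _ + `|X|]mulrAC -exprSr.
  have s20 : 2 * s != 0 by rewrite mulf_neq0.
  have p2 := normal_pdf_ub 0 (u n) s20.
  have leP c : c * normal_pdf 0 (2 * s) (u n) <= `|c| * normal_peak (2 * s).
    rewrite (@le_trans _ _ (`|c| * normal_pdf 0 (2 * s) (u n)))//.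
      by rewrite ler_wpM2r ?normal_pdf_ge0 ?ler_norm.
    by rewrite ler_wpM2l.
  by apply: lerD; [exact: le_trans (leC _) _|exact: le_trans (leC' _) _].
have B0 : B * harmonic n @[n --> \oo] --> (0 : R).
  rewrite -[X in _ --> X](mulr0 B).
  by apply: cvgM; [exact: cvg_cst|exact: cvg_harmonic].
apply: (@squeeze_cvgr _ _ _ _ (fun n => - (B * harmonic n))
    (fun n => B * harmonic n)).
- by near=> n; rewrite -ler_norml.
- by rewrite -[X in _ --> X]oppr0; exact: cvgN.
- exact: B0.
Unshelve. all: by end_near. Qed.

Lemma integral_Xn_normal_pdf k :
  (\int[mu]_x (x ^+ k * normal_pdf 0 s x)%:E = (normal_moment k)%:E)%E.
Proof.
have rec j : (\int[mu]_x (j%:R * (x ^+ j.-1 * normal_pdf 0 s x)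
     - s ^- 2 * (x ^+ j.+1 * normal_pdf 0 s x))%:E = 0)%E.
  apply: (integral_derive_eq0 _ (is_derive_Xn_normal_pdf j)).
  - move=> x; apply: cvgB; apply: cvgM; [exact: cvg_cst|
      exact: continuous_Xn_normal_pdf|exact: cvg_cst|
      exact: continuous_Xn_normal_pdf].
  - have := integrableB measurableT
      (integrableZl measurableT j%:R (integrable_Xn_normal_pdf j.-1))
      (integrableZl measurableT (s ^- 2) (integrable_Xn_normal_pdf j.+1)).
    by [].
  - by apply: cvg_Xn_normal_pdf0 => n; rewrite normr_nat.
  - by apply: cvg_Xn_normal_pdf0 => n; rewrite normrN normr_nat.
have rec' j : (j%:R%:E * \int[mu]_x (x ^+ j.-1 * normal_pdf 0 s x)%:E =
    (s ^- 2)%:E * \int[mu]_x (x ^+ j.+1 * normal_pdf 0 s x)%:E)%E.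
  have := rec j; under eq_integral do rewrite EFinB !EFinM.
  have iX i := integrable_Xn_normal_pdf i.
  rewrite (integralB measurableT (integrableZl measurableT _ (iX j.-1))
    (integrableZl measurableT _ (iX j.+1))).
  rewrite (integralZl measurableT (iX j.-1)) (integralZl measurableT (iX j.+1)).
  (* Both integrals are finite, so the vanishing difference in [\bar R] becomes an equality of
     reals. *)
  move: (integrable_fin_num measurableT (iX j.-1))
    (integrable_fin_num measurableT (iX j.+1)) => /fineK <- /fineK <-.
  by rewrite -!EFinM -EFinB => -[/subr0_eq ->].
have step j m : (\int[mu]_x (x ^+ j.-1 * normal_pdf 0 s x)%:E = m%:E ->
   \int[mu]_x (x ^+ j.+1 * normal_pdf 0 s x)%:E = (j%:R * s ^+ 2 * m)%:E)%E.
  move=> jm; have /(congr1 (fun e => (s ^+ 2)%:E * e)%E) := rec' j.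
  rewrite [RHS]muleA -EFinM mulfV ?expf_neq0// mul1e => <-.
  by rewrite jm -!EFinM mulrCA mulrA.
elim/ltn_ind: k => -[|[|k]] IH.
- by under eq_integral do rewrite mul1r; exact: integral_normal_pdf.
(* The first moment is the case j = 0: since [0.-1] is 0 the premise is total mass 1, and the
   coefficient j = 0 makes the result 0. *)
- rewrite (step 0%N 1) ?mul0r//.
  by under eq_integral do rewrite mul1r; exact: integral_normal_pdf.
- by rewrite (step k.+1 _ (IH k _))//=.
Qed.

End normal_moments.

(** * Fubini on tuples and the d-dimensional Gaussian *)

(** Induction on n, peeling off one coordinate. Integrability is carried along with the value
    because Fubini at the next stage needs it for the tail. *)
Lemma integral_tuple_prod (R : realType) (n : nat) (f : 'I_n -> R -> R)
    (m : 'I_n -> R) :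
  (forall i, (@lebesgue_measure R).-integrable setT (EFin \o f i)) ->
  (forall i, (\int[@lebesgue_measure R]_x (f i x)%:E = (m i)%:E)%E) ->
  let F (t : n.-tuple (measurableTypeR R)) := (\prod_i f i (tnth t i))%:E in
  (lebesgue_tuple R n).-integrable setT F /\
  (\int[lebesgue_tuple R n]_t F t = (\prod_i m i)%:E)%E.
Proof.
elim: n f m => [|n IH] f m fi fm F.
  have -> : F = cst 1%E by apply/funext => t; rewrite /F big_ord0.
  split; first exact: (finite_measure_integrable_cst \d_([tuple]) 1).
  by rewrite integral_dirac// diracT mul1e big_ord0.
have [Gi Gm] := IH (fun i => f (lift ord0 i)) (fun i => m (lift ord0 i))
  (fun i => fi _) (fun i => fm _).
set g := (fun t : n.-tuple _ => _%:E) in Gi Gm.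
pose f0 := EFin \o f ord0.
pose H (p : measurableTypeR R * n.-tuple (measurableTypeR R)) : \bar R :=
  (f0 p.1 * g p.2)%E.
have FH : F \o @cons_pair R n = H.
  apply/funext => -[x t] /=; rewrite /F /H /g /f0 /= big_ord_recl EFinM tnth0.
  by congr (_ * _%:E)%E; apply: eq_bigr => i _; rewrite tnthS.
have mH : measurable_fun setT H.
  apply: emeasurable_funM; apply: measurableT_comp => //.
  - exact: measurable_int (fi ord0).
  - exact: measurable_int Gi.
have mF : measurable_fun setT F.
  rewrite -(_ : H \o @uncons_pair R n = F).
    by apply: measurableT_comp => //; exact: measurable_uncons_pair.
  by rewrite -FH; apply/funext => t /=; rewrite uncons_pairK.
(* Tonelli: the iterated integral of |H| factors into two finite integrals. *)
have iH : ((@lebesgue_measure R) \x (lebesgue_tuple R n))%E.-integrable setT H.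
  apply/integrable12ltyP => //.
  have HE x : (\int[lebesgue_tuple R n]_t `|H (x, t)| =
               `|f ord0 x|%:E * \int[lebesgue_tuple R n]_t `|g t|)%E.
    rewrite -(integralZl measurableT (integrable_abse Gi)).
    by apply: eq_integral => t _; exact: abseM.
  under eq_integral do rewrite HE.
  have fg := integrable_fin_num measurableT (integrable_abse Gi).
  have ff := integrable_fin_num measurableT (integrable_abse (fi ord0)).
  rewrite -(fineK fg) (integralZr measurableT (integrable_abse (fi ord0))).
  by rewrite -(fineK ff) -EFinM ltry.
have iHF : ((@lebesgue_measure R) \x (lebesgue_tuple R n))%E.-integrable
    (@cons_pair R n @^-1` setT) (F \o @cons_pair R n).
  by rewrite preimage_setT FH; exact: iH.
split; first exact: (integrable_pushforward (@measurable_cons_pair R n) mF iHF).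
rewrite /= (integral_pushforward (@measurable_cons_pair R n) mF iHF)//.
rewrite preimage_setT FH -(integral12_prod_meas1 iH) /fubini_F /H /=.
under eq_integral do rewrite (integralZl measurableT Gi) Gm.
by rewrite (integralZr measurableT (fi ord0)) fm -EFinM big_ord_recl.
Qed.

Lemma gaussian_density_scalar (R : realType) (d : nat) (v : R)
    (y : 'rV[R]_d) : 0 < v ->
  gaussian_density 0 v%:M y = \prod_i normal_pdf 0 (Num.sqrt v) (y 0 i).
Proof.
move=> v0; have sv0 : Num.sqrt v != 0 by rewrite gt_eqF// sqrtr_gt0.
rewrite normal_pdfE// /normal_peak /normal_fun sqr_sqrtr ?(ltW v0)//.
rewrite big_split /= prodr_const card_ord -expR_sum.
rewrite /gaussian_density det_scalar -exprMn invmx_scalar subr0.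
congr (_ * expR _).
  rewrite exprVn; congr (_^-1).
  rewrite (_ : 2 * pi * v = v * pi *+ 2); last by ring.
  have a0 : 0 <= v * pi *+ 2 by rewrite mulrn_wge0// mulr_ge0 ?pi_ge0 ?ltW.
  (* The square root of a d-th power is the d-th power of the square root, by induction on d. *)
  elim: d {y} => [|d IH]; first by rewrite !expr0 sqrtr1.
  by rewrite !exprS sqrtrM// IH.
rewrite mul_mx_scalar -scalemxAl !mxE -mulNr mulr_sumr mulr_suml.
apply: eq_bigr => i _; rewrite mxE subr0; field.
exact: lt0r_neq0.
Qed.

Lemma integral_monomial_gauss_kernel (R : realType) (d : nat) (nu dt : R)
    (alpha : 'I_d -> nat) : 0 < nu -> 0 < dt ->
  integral_Rd (fun y => monomial alpha y * gauss_kernel nu dt y) =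
  (\prod_i normal_moment (Num.sqrt (2 * nu * dt)) (alpha i))%:E.
Proof.
move=> nu0 dt0; have v0 : 0 < 2 * nu * dt by rewrite !mulr_gt0.
have s0 : Num.sqrt (2 * nu * dt) != 0 by rewrite gt_eqF// sqrtr_gt0.
have [_ <-] := integral_tuple_prod
  (fun i => integrable_Xn_normal_pdf s0 (alpha i))
  (fun i => integral_Xn_normal_pdf s0 (alpha i)).
apply: eq_integral => t _; congr (_%:E).
rewrite /gauss_kernel gaussian_density_scalar// /monomial -big_split /=.
by apply: eq_bigr => i _; rewrite mxE.
Qed.

(** * Expansion of the quadrature sum *)

(** Symmetry makes the parts i < j and j < i equal. Nodes are indexed by i < j, but isolating one
    coordinate is simpler over ordered pairs. *)
Lemma sum_neq_ltn (R : pzRingType) (d : nat) (G : 'I_d -> 'I_d -> R) :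
  (forall i j, G i j = G j i) ->
  \sum_(i : 'I_d) \sum_(j | j != i) G i j =
  2 * \sum_(p : {p : 'I_d * 'I_d | (p.1 < p.2)%N}) G (val p).1 (val p).2.
Proof.
move=> GC.
have -> : \sum_(p : {p : 'I_d * 'I_d | (p.1 < p.2)%N}) G (val p).1 (val p).2 =
    \sum_(i : 'I_d) \sum_(j : 'I_d | (i < j)%N) G i j.
  rewrite pair_big_dep /=.
  rewrite (reindex_omap (val : {p : 'I_d * 'I_d | (p.1 < p.2)%N} -> _) insub).
    by apply: eq_bigl => p; rewrite valK eqxx andbT (valP p).
  by move=> p pP; rewrite insubT.
have -> : 2 * \sum_(i : 'I_d) \sum_(j : 'I_d | (i < j)%N) G i j =
    \sum_(i : 'I_d) \sum_(j : 'I_d | (i < j)%N) G i j +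
    \sum_(i : 'I_d) \sum_(j : 'I_d | (j < i)%N) G i j.
  rewrite mulr2n mulrDl mul1r; congr (_ + _).
  rewrite [RHS](exchange_big_dep xpredT)//=.
  by apply: eq_bigr => i _; apply: eq_bigr => j _; exact: GC.
rewrite -big_split; apply: eq_bigr => i _ /=.
rewrite (bigID (fun j : 'I_d => (i < j)%N))/=.
congr (_ + _); apply: eq_bigl => j.
  by rewrite -val_eqE /= neq_ltn; case: ltngtP.
by rewrite -val_eqE /= neq_ltn; case: ltngtP.
Qed.

Lemma big_option (V : nmodType) (I : finType) (F : option I -> V) :
  \sum_o F o = F None + \sum_i F (Some i).
Proof.
rewrite (bigD1 None)//=; congr (_ + _).
rewrite (reindex_omap Some id); last by case.
by apply: eq_bigl => i /=; rewrite eqxx.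
Qed.

Section quadrature.
Context (R : realType) (d : nat) (r : R) (alpha : 'I_d -> nat).

Let e i : 'rV[R]_d := delta_mx 0 i.

(* The sum of [x^k] over [x = r] and [x = -r]. *)
Definition sign_sum (k : nat) : R := (1 + (-1) ^+ k) * r ^+ k.

(** As 0^0 = 1, the remaining product is the indicator that [alpha] vanishes away from i. *)
Lemma monomial_axis (c : R) (i : 'I_d) :
  monomial alpha (c *: e i) =
  c ^+ alpha i * \prod_(k | k != i) 0 ^+ alpha k.
Proof.
rewrite /monomial (bigD1 i)//= !mxE !eqxx mulr1; congr (_ * _).
by apply: eq_bigr => k ki; rewrite !mxE eqxx/= (negbTE ki) mulr0.
Qed.

Lemma monomial_diag (a b : R) (i j : 'I_d) : j != i ->
  monomial alpha (a *: e i + b *: e j) =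
  a ^+ alpha i * b ^+ alpha j *
  \prod_(k | (k != i) && (k != j)) 0 ^+ alpha k.
Proof.
move=> ji; rewrite /monomial (bigD1 i)//= (bigD1 j)//= !mxE !eqxx/=.
rewrite (negbTE ji) eq_sym (negbTE ji) !mulr1 !mulr0 addr0 add0r mulrA.
congr (_ * _); apply: eq_bigr => k /andP[ki kj].
by rewrite !mxE eqxx/= (negbTE ki) (negbTE kj) !mulr0 addr0.
Qed.

Lemma monomial0 : monomial alpha (0 : 'rV[R]_d) = \prod_k 0 ^+ alpha k.
Proof. by apply: eq_bigr => k _; rewrite mxE. Qed.

(** The coordinates of the four nodes of a pair run through all independent choices (r or -r, r or
    -r), so their sum factors into two sign sums. *)
Lemma quadrature_sum (w0 wA wD : R) :
  \sum_(l : node_index d) weight w0 wA wD l * monomial alpha (node r l) =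
  w0 * \prod_k 0 ^+ alpha k +
  wA * \sum_i sign_sum (alpha i) * \prod_(k | k != i) 0 ^+ alpha k +
  wD / 2 * \sum_i \sum_(j | j != i) sign_sum (alpha i) * sign_sum (alpha j) *
    \prod_(k | (k != i) && (k != j)) 0 ^+ alpha k.
Proof.
rewrite sum_neq_ltn; last first.
  move=> i j; rewrite (mulrC (sign_sum _)); congr (_ * _).
  by apply: eq_bigl => k; rewrite andbC.
rewrite mulrA divfK ?pnatr_eq0//.
rewrite big_option /= monomial0 -addrA; congr (_ + _).
rewrite big_sumType /=; congr (_ + _).
  transitivity (\sum_i \sum_(s : bool)
      wA * monomial alpha ((-1) ^+ s *: (r *: e i))).
    by rewrite pair_bigA; apply: eq_bigr => -[i s].
  rewrite mulr_sumr.
  apply: eq_bigr => i _; rewrite big_bool /= -mulrDr; congr (_ * _).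
  rewrite !scalerA !monomial_axis expr0 expr1 /sign_sum.
  by rewrite mulN1r mul1r (exprNn r); ring.
transitivity (\sum_(p : {p : 'I_d * 'I_d | (p.1 < p.2)%N})
    \sum_(s : bool) \sum_(t : bool) wD * monomial alpha
      ((-1) ^+ s *: (r *: (e (val p).1 + (-1) ^+ t *: e (val p).2)))).
  under [RHS]eq_bigr do rewrite pair_bigA.
  by rewrite pair_bigA; apply: eq_bigr => -[p [s t]].
rewrite mulr_sumr; apply: eq_bigr => p _.
rewrite !big_bool /= !scalerDr !scalerA.
have p12 : (val p).2 != (val p).1 by rewrite -val_eqE /= neq_ltn (valP p) orbT.
rewrite !monomial_diag// !expr1 !expr0 !mulN1r !mul1r !mulr1 !mulrN1 opprK.
rewrite !(exprNn r) /sign_sum.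
ring.
Qed.

End quadrature.

(** * Matching the expanded sum with the Gaussian moments *)

Lemma prod_expr0_eq1 (R : pzSemiRingType) (I : finType) (P : pred I)
    (a : I -> nat) :
  (forall k, P k -> a k = 0%N) -> \prod_(k | P k) (0 : R) ^+ a k = 1.
Proof. by move=> a0; apply: big1 => k /a0 ->. Qed.

Lemma prod_expr0_eq0 (R : comPzSemiRingType) (I : finType) (P : pred I)
    (a : I -> nat) (k : I) :
  P k -> a k != 0%N -> \prod_(k | P k) (0 : R) ^+ a k = 0.
Proof. by move=> Pk ak; rewrite (bigD1 k)//= expr0n (negbTE ak) mul0r. Qed.

Lemma sumr_const_ord (R : pzSemiRingType) (d : nat) (c : R) :
  \sum_(i < d) c = d%:R * c.
Proof. by rewrite sumr_const card_ord mulr_natl. Qed.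

Lemma sumr_const_neq (R : pzRingType) (d : nat) (i : 'I_d) (c : R) :
  \sum_(j | j != i) c = (d%:R - 1) * c.
Proof.
have := sumr_const_ord d c; rewrite (bigD1 i)//= => /(canRL (addKr c)) ->.
by rewrite mulrBl mul1r addrC.
Qed.

Lemma normal_moment_odd (R : realType) (s : R) (k : nat) :
  odd k -> normal_moment s k = 0.
Proof.
elim/ltn_ind: k => -[|[|k]]//= IH /negPn ok.
by rewrite IH ?mulr0// ltnW.
Qed.

Section sign_sum.
Context (R : realType) (r : R).

Lemma sign_sum_odd k : odd k -> sign_sum r k = 0.
Proof. by move=> ok; rewrite /sign_sum -signr_odd ok expr1 subrr mul0r. Qed.

Lemma sign_sum_even k : ~~ odd k -> sign_sum r k = 2 * r ^+ k.
Proof. by move=> ek; rewrite /sign_sum -signr_odd (negbTE ek). Qed.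

End sign_sum.

(* The three sums on the left run over the central, axial and diagonal nodes;
   [wD] is halved because the diagonal sum is over ordered pairs. *)
Lemma quadrature_eq_normal_moments (R : realType) (d : nat) (r s w0 wA wD : R)
  (s2 : s ^+ 2 = r ^+ 2 / 3)
  (w0_def : w0 = (d%:R ^+ 2 - 7 * d%:R + 18) / 18)
  (wA_def : wA = (4 - d%:R) / 18)
  (wD_def : wD = 1 / 36)
  (alpha : 'I_d -> nat) (halpha : (\sum_(i < d) alpha i <= 5)%N) :
  w0 * \prod_k 0 ^+ alpha k +
  wA * \sum_i sign_sum r (alpha i) * \prod_(k | k != i) 0 ^+ alpha k +
  wD / 2 * \sum_i \sum_(j | j != i)
    sign_sum r (alpha i) * sign_sum r (alpha j) *
    \prod_(k | (k != i) && (k != j)) 0 ^+ alpha k =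
  \prod_i normal_moment s (alpha i).
Proof.
case: (pickP (fun k => odd (alpha k))) => [k ko|ev].
  have k0 : alpha k != 0%N by case: (alpha k) ko.
  rewrite [RHS](bigD1 k)//= normal_moment_odd// mul0r.
  rewrite (prod_expr0_eq0 _ _ k0)// mulr0 add0r.
  rewrite big1 ?mulr0 ?add0r; last first.
    move=> i _; have [->|ik] := eqVneq i k.
      by rewrite sign_sum_odd ?mul0r.
    by rewrite (prod_expr0_eq0 _ _ k0) ?mulr0// eq_sym.
  rewrite big1 ?mulr0// => i _; rewrite big1// => j ji.
  have [->|ik] := eqVneq i k; first by rewrite sign_sum_odd ?mul0r.
  have [->|jk] := eqVneq j k; first by rewrite (sign_sum_odd _ ko) mulr0 mul0r.
  by rewrite (prod_expr0_eq0 _ _ k0) ?mulr0// eq_sym ik eq_sym.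
have {}ev k : ~~ odd (alpha k) by rewrite ev.
have qE k : sign_sum r (alpha k) = 2 * r ^+ alpha k by rewrite sign_sum_even.
case: (pickP (fun k => alpha k != 0%N)) => [k k0|z]; last first.
  (* Zero multi-index: the weights add up to w0 + 2d wA + 2d(d-1) wD = 1. *)
  have {}z k : alpha k = 0%N by apply/eqP; have /negbFE := z k.
  rewrite prod_expr0_eq1// [RHS]big1; last by move=> i _; rewrite z.
  rewrite [X in wA * X](eq_bigr (fun=> 2)); last first.
    by move=> i _; rewrite prod_expr0_eq1// qE z expr0 !mulr1.
  rewrite [X in wD / 2 * X](eq_bigr (fun=> (d%:R - 1) * 4)); last first.
    move=> i _; rewrite -(sumr_const_neq i); apply: eq_bigr => j _.
    by rewrite prod_expr0_eq1// !qE !z expr0; ring.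
  rewrite (sumr_const_ord d 2) (sumr_const_ord d ((d%:R - 1) * 4)).
  by rewrite w0_def wA_def wD_def; field.
rewrite (prod_expr0_eq0 _ _ k0)// mulr0 add0r.
case: (pickP (fun l => (l != k) && (alpha l != 0%N))) => [l /andP[lk l0]|z].
  (* Nonzero even exponents are at least 2: two of them within total 5 are both 2, and a third would
     force the total to 6. *)
  have [k2 l2 z] : [/\ alpha k = 2%N, alpha l = 2%N &
      forall m, m != k -> m != l -> alpha m = 0%N].
    have sum_kl := halpha; rewrite (bigD1 k)//= (bigD1 l)//= in sum_kl.
    have [evk evl] := (ev k, ev l).
    split; [by lia|by lia|move=> m mk ml].
    rewrite (bigD1 m) ?mk//= in sum_kl.
    by have evm := ev m; lia.
  rewrite big1 ?mulr0 ?add0r; last first.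
    move=> i _; have [->|ik] := eqVneq i k.
      by rewrite (prod_expr0_eq0 _ _ l0) ?mulr0.
    by rewrite (prod_expr0_eq0 _ _ k0) ?mulr0// eq_sym.
  (* Only the ordered pairs (k, l) and (l, k) survive, each worth 4 r^4, and 8 r^4 wD / 2 = r^4 / 9
     = s^4. *)
  pose T i j := sign_sum r (alpha i) * sign_sum r (alpha j) *
    \prod_(m | (m != i) && (m != j)) 0 ^+ alpha m.
  have T0l i j : i != l -> j != l -> T i j = 0.
    move=> il jl; rewrite /T (prod_expr0_eq0 _ _ l0) ?mulr0 //.
    by rewrite ![l == _]eq_sym il.
  have T0k i j : i != k -> j != k -> T i j = 0.
    move=> ik jk; rewrite /T (prod_expr0_eq0 _ _ k0) ?mulr0 //.
    by rewrite ![k == _]eq_sym ik.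
  have Tkl : T k l = 4 * r ^+ 4.
    rewrite /T prod_expr0_eq1 => [|m /andP[]]; last exact: z.
    by rewrite !qE k2 l2; ring.
  have Tlk : T l k = 4 * r ^+ 4.
    rewrite /T prod_expr0_eq1 => [|m /andP[ml mk]]; last exact: z.
    by rewrite !qE k2 l2; ring.
  have -> : \sum_i \sum_(j | j != i) T i j = 8 * r ^+ 4.
    have kl : k != l by rewrite eq_sym.
    rewrite (bigD1 k)//= (bigD1 l)//= Tkl.
    rewrite big1 => [|j /andP[_ jl]]; last exact: T0l.
    rewrite (bigD1 l)//= (bigD1 k)//= Tlk.
    rewrite big1 => [|j /andP[_ jk]]; last exact: T0k.
    rewrite big1 => [|i /andP[ik il]]; first by ring.
    rewrite big1// => j ji; have [jk|] := eqVneq j k; last exact: T0k.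
    by rewrite T0l// jk.
  rewrite [RHS](bigD1 k)//= (bigD1 l)//= big1; last first.
    by move=> m /andP[mk ml]; rewrite z.
  by rewrite k2 l2 /= s2 wD_def; field.
have {}z l : l != k -> alpha l = 0%N.
  by move=> lk; apply/eqP; have := z l; rewrite lk => /negbFE.
rewrite (bigD1 k)//= prod_expr0_eq1//.
rewrite [X in wA * (_ + X)]big1 ?addr0; last first.
  by move=> i ik; rewrite (prod_expr0_eq0 _ _ k0) ?mulr0// eq_sym.
(* The surviving ordered pairs contain k: d-1 with i = k and d-1 with j = k, each worth 4 r^(alpha
   k). *)
rewrite [X in wD / 2 * X](bigD1 k)//=.
rewrite [X in wD / 2 * (X + _)](eq_bigr (fun=> 4 * r ^+ alpha k));
  last first.
  move=> j jk; rewrite !qE (z _ jk) prod_expr0_eq1; first by ring.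
  by move=> m /andP[mk _]; exact: z.
rewrite [X in wD / 2 * (_ + X)](eq_bigr (fun=> 4 * r ^+ alpha k));
  last first.
  move=> i ik; have ki : k != i by rewrite eq_sym.
  rewrite (bigD1 k)//= [X in _ + X]big1 ?addr0; last first.
    move=> j /andP[ji jk]; rewrite (prod_expr0_eq0 _ _ k0) ?mulr0//.
    by rewrite ki eq_sym.
  rewrite !qE (z _ ik) prod_expr0_eq1; first by ring.
  by move=> m /andP[_ mk]; exact: z.
rewrite !sumr_const_neq [RHS](bigD1 k)//= big1 => [|i ik]; last by rewrite z.
(* With a = alpha k the left side is r^a ((4-d)/9 + (d-1)/9) = r^a / 3, which is s^2 for a = 2 and 3
   s^4 for a = 4 because r^2 = 3 s^2. *)
have [k2|k4] : alpha k = 2%N \/ alpha k = 4%N.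
  have := halpha; rewrite (bigD1 k)//=.
  by have evk := ev k; lia.
- by rewrite qE k2 /= s2 wA_def wD_def; field.
- by rewrite qE k4 /= s2 wA_def wD_def; field.
Qed.

Theorem proposition3p2 (R : realType) (d : nat) (r nu dt w0 wA wD : R)
  (hd : (1 <= d)%N) (hr : 0 < r) (hnu : 0 < nu) (hdt : 0 < dt)
  (r_def : r = Num.sqrt (6 * nu * dt))
  (w0_def : w0 = (d%:R ^+ 2 - 7 * d%:R + 18) / 18)
  (wA_def : wA = (4 - d%:R) / 18)
  (wD_def : wD = 1 / 36)
  (alpha : 'I_d -> nat) (halpha : (\sum_(i < d) alpha i <= 5)%N) :
  (\sum_(l : node_index d) weight w0 wA wD l * monomial alpha (node r l))%:E =
  integral_Rd (fun y => monomial alpha y * gauss_kernel nu dt y).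
Proof.
have a0 : 0 <= 6 * nu * dt by rewrite !mulr_ge0 ?ltW.
rewrite integral_monomial_gauss_kernel// quadrature_sum; congr (_%:E).
apply: quadrature_eq_normal_moments => //.
by rewrite r_def !sqr_sqrtr ?mulr_ge0 ?ltW//; field.
Qed.
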